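(* A completable queue implementation is linearizable (with respect to the queue specification) if and only if none of its complete induced histories has a $\mathsf{VFresh}$, $\mathsf{VRepet}$, $\mathsf{VOrd}$ or $\mathsf{VWit}$ violation.
   Context: Queue events, histories: an event is a tuple $(u,m,d_{in},d_{out})$ with unique identifier $u$, $m\in\{\mathtt{enq},\mathtt{deq}\}$; $\mathtt{enq}(x)$ enqueues $x\in\mathbb{N}$, $\mathtt{deq}(x)$ returns $x\in\mathbb{N}\cup\{\mathtt{NULL}\}$. Each event has invocation $\mathit{inv}$ and response $\mathit{res}$; a history is a finite sequence of such actions, each at most once, responses after invocations; an event is pending if only invoked; a history is complete if none is pending. $e\prec_c e'$ iff $\mathit{res}(e)$ precedes $\mathit{inv}(e')$. A completion of $c$ is a complete history obtained from $c\cdot c'$, with $c'$ consisting only of response actions, by deleting actions of still-pending events; $\mathrm{Compl}(c)$ is the set of completions. A behavior (event sequence) is legal if it labels a run from $\varepsilon$ of $\mathsf{LTS}_Q$ (states: finite sequences over $\mathbb{N}$; $q\xrightarrow{\mathtt{enq}(x)}q\cdot x$, $x\cdot q'\xrightarrow{\mathtt{deq}(x)}q'$, $\varepsilon\xrightarrow{\mathtt{deq}(\mathtt{NULL})}\varepsilon$). A history $c$ is linearizable if some $\hat c\in\mathrm{Compl}(c)$ admits a legal ordering $s$ of its events with $e\prec_{\hat c}e'\Rightarrow e$ before $e'$ in $s$. An implementation is a set of execution traces, each inducing a history (invocation at method entry, response at method exit); it is linearizable if all its induced histories are, and completable if for every induced history $c$, $\mathrm{Compl}(c)$ contains some induced history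 of the implementation. Each value is assumed enqueued at most once. Violations of a complete history $c$ (with $\mathrm{Enq}(c)$, $\mathrm{Deq}(c)$, $\mathrm{Val}(c,e)$ its enqueue events, dequeue events, and event values): ($\mathsf{VFresh}$) some $x\neq\mathtt{NULL}$ has $\mathtt{deq}(x)\in\mathrm{Deq}(c)$ and either $\mathtt{enq}(x)\notin\mathrm{Enq}(c)$ or $\mathtt{deq}(x)\prec_c\mathtt{enq}(x)$; ($\mathsf{VRepet}$) distinct $d,d'\in\mathrm{Deq}(c)$ with $\mathrm{Val}(c,d)=\mathrm{Val}(c,d')\neq\mathtt{NULL}$; ($\mathsf{VOrd}$) values $x,y$ with $\mathtt{enq}(y)\prec_c\mathtt{enq}(x)$, $\mathtt{deq}(x)\in\mathrm{Deq}(c)$, and either no dequeue of $y$ in $c$ or $\mathtt{deq}(x)\prec_c\mathtt{deq}(y)$; ($\mathsf{VWit}$) a dequeue $d$ returning $\mathtt{NULL}$ with $c=c_0\cdot\mathit{inv}(d)\cdot c_d\cdot\mathit{res}(d)\cdot c_3$ such that for every split $c_d=c_1\cdot c_2$ some $\mathtt{enq}(x)$ is completed in $c_0\cdot\mathit{inv}(d)\cdot c_1$ while no dequeue returning $x$ is invoked in $c_0\cdot\mathit{inv}(d)\cdot c_1$. *)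

(* Defs.v *)
From HB Require Import structures.
From mathcomp Require Import all_boot.

Set Implicit Arguments.
Unset Strict Implicit.
Unset Printing Implicit Defensive.

(* [Enq x] is enq(x); [Deq (Some x)] is deq(x); [Deq None] is deq(NULL). *)
Inductive op := Enq of nat | Deq of option nat.

Definition op_eq_dec (o o' : op) : {o = o'} + {o <> o'}.
Proof. by decide equality; apply: eq_comparable. Defined.

HB.instance Definition _ := hasDecEq.Build op (compareP op_eq_dec).

(* The tuple (u, m, d_in, d_out): [op] bundles the method with its input (enq)
   or its output (deq), the other component being absent. *)
Definition event : Type := (nat * op)%type.
Definition uid (e : event) : nat := e.1.
Definition op_of (e : event) : op := e.2.

(* An invocation carries the identifier, the method and the input; a response
   carries the identifier, the method and the output.  In particular the
   invocation of a dequeue does not determine the value it returns. *)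
Inductive action :=
  | InvEnq of nat & nat
  | InvDeq of nat
  | ResEnq of nat
  | ResDeq of nat & option nat.

Definition action_eq_dec (a b : action) : {a = b} + {a <> b}.
Proof. by decide equality; apply: eq_comparable. Defined.

HB.instance Definition _ := hasDecEq.Build action (compareP action_eq_dec).

Definition inv (e : event) : action :=
  match op_of e with Enq x => InvEnq (uid e) x | Deq _ => InvDeq (uid e) end.

Definition res (e : event) : action :=
  match op_of e with Enq _ => ResEnq (uid e) | Deq v => ResDeq (uid e) v end.

Definition is_inv (a : action) : bool :=
  match a with InvEnq _ _ | InvDeq _ => true | _ => false end.

Definition is_res (a : action) : bool := ~~ is_inv a.

Definition act_uid (a : action) : nat :=
  match a with InvEnq u _ | InvDeq u | ResEnq u | ResDeq u _ => u end.

Definition history (c : seq action) : Prop :=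
  [/\ uniq [seq act_uid a | a <- c & is_inv a],
      uniq [seq act_uid a | a <- c & is_res a] &
      forall c0 a c1, c = c0 ++ a :: c1 -> is_res a ->
        exists2 e : event, a = res e & inv e \in c0].

Definition pending (c : seq action) (u : nat) : bool :=
  has (fun a => is_inv a && (act_uid a == u)) c
  && ~~ has (fun a => is_res a && (act_uid a == u)) c.

Definition complete (c : seq action) : Prop := forall u, ~~ pending c u.

Definition completed (c : seq action) (e : event) : bool :=
  (inv e \in c) && (res e \in c).

(* [mem2 c a b]: [a] occurs in [c] and [b] occurs in [c] no earlier than [a].
   Actions occur at most once in a history and [res e != inv e'], so this is
   strict precedence. *)
Definition hb (c : seq action) (e e' : event) : bool :=
  mem2 c (res e) (inv e').

Definition remove_pending (c : seq action) : seq action :=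
  [seq a <- c | ~~ pending c (act_uid a)].

Definition compl (c hc : seq action) : Prop :=
  [/\ history hc, complete hc &
      exists c', [/\ all is_res c', history (c ++ c')
                   & hc = remove_pending (c ++ c')]].

Inductive lts_step : seq nat -> op -> seq nat -> Prop :=
  | step_enq q x : lts_step q (Enq x) (rcons q x)
  | step_deq x q : lts_step (x :: q) (Deq (Some x)) q
  | step_null : lts_step [::] (Deq None) [::].

Inductive lts_run : seq nat -> seq event -> seq nat -> Prop :=
  | run_nil q : lts_run q [::] q
  | run_cons q e q' s q'' :
      lts_step q (op_of e) q' -> lts_run q' s q'' -> lts_run q (e :: s) q''.

Definition legal (s : seq event) : Prop := exists q, lts_run [::] s q.

Definition ordering_of (c : seq action) (s : seq event) : Prop :=
  uniq s /\ (forall e, (e \in s) = completed c e).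

Definition linearizable (c : seq action) : Prop :=
  exists hc, compl c hc /\
  exists s, [/\ ordering_of hc s, legal s &
    forall e e', e \in s -> e' \in s -> hb hc e e' -> index e s < index e' s].

(* A step of an execution is either the entry/exit of a method, recorded as the
   corresponding invocation/response action, or internal, with labels in [I]. *)
Inductive trace_step (I : Type) :=
  | Interface of action
  | Internal of I.
Arguments Internal {I}.
Arguments Interface {I}.

Definition trace (I : Type) := seq (trace_step I).

Definition induced_history (I : Type) (t : trace I) : seq action :=
  pmap (fun s => if s is Interface a then Some a else None) t.

Record implementation (I : Type) := Implementation {
  traces : trace I -> Prop;
  traces_history : forall t, traces t -> history (induced_history t)
}.

Definition induces (I : Type) (P : implementation I) (c : seq action) : Prop :=
  exists2 t, traces P t & c = induced_history t.

Definition impl_linearizable (I : Type) (P : implementation I) : Prop :=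
  forall c, induces P c -> linearizable c.

Definition completable (I : Type) (P : implementation I) : Prop :=
  forall c, induces P c -> exists2 hc, compl c hc & induces P hc.

Definition enqueued_once (c : seq action) : Prop :=
  forall u u' x, InvEnq u x \in c -> InvEnq u' x \in c -> u = u'.

(* [enq_in c x e]: [e] is an event enq(x) in Enq(c); [deq_in c v e]: [e] is in
   Deq(c) and returns [v].  Meant for complete [c], whose events are exactly
   those completed in [c]. *)
Definition enq_in (c : seq action) (x : nat) (e : event) : Prop :=
  completed c e /\ op_of e = Enq x.

Definition deq_in (c : seq action) (v : option nat) (e : event) : Prop :=
  completed c e /\ op_of e = Deq v.

Definition VFresh (c : seq action) : Prop :=
  exists x d, deq_in c (Some x) d /\
    ((forall e, ~ enq_in c x e) \/ (exists2 e, enq_in c x e & hb c d e)).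

Definition VRepet (c : seq action) : Prop :=
  exists x d d',
    [/\ d <> d', deq_in c (Some x) d & deq_in c (Some x) d'].

Definition VOrd (c : seq action) : Prop :=
  exists x y ex ey dx,
    [/\ enq_in c x ex, enq_in c y ey, hb c ey ex, deq_in c (Some x) dx &
        (forall dy, ~ deq_in c (Some y) dy) \/
        (exists2 dy, deq_in c (Some y) dy & hb c dx dy)].

(* The value returned by a dequeue invoked in a prefix of [c] is read off from
   its response in [c], which may lie outside that prefix. *)
Definition VWit (c : seq action) : Prop :=
  exists d c0 cd c3,
    [/\ deq_in c None d, c = c0 ++ inv d :: cd ++ res d :: c3 &
        forall c1 c2, cd = c1 ++ c2 ->
          exists x e,
            [/\ op_of e = Enq x, completed (c0 ++ inv d :: c1) e &
                forall d', deq_in c (Some x) d' ->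
                  inv d' \notin c0 ++ inv d :: c1]].

(* Main.v *)
From mathcomp Require Import all_boot.
From mathcomp Require Import zify.
Require Import Defs.

Set Implicit Arguments.
Unset Strict Implicit.
Unset Printing Implicit Defensive.

(* A complete history is its own only completion, so it suffices to show that a
   complete history is linearizable iff it has no violation.  For the converse,
   no VWit violation means that every NULL dequeue d has an instant p_d such
   that the values enqueued before p_d have their dequeues invoked before p_d.
   For a value x let M x be the latest invocation of enq(x) and deq(x) (infinite
   if x is not dequeued) and L x the maximum of inv(enq x) and of the p_d < M x.
   Then x must precede y in the queue as soon as res(enq x) < L y or
   res(deq x) < M y.  These are two interval orders, and the absence of
   violations forbids 2-cycles in their union, hence all cycles.  Along a
   compatible order of the values, placing enq(x) at the running maximum of L,
   deq(x) at the running maximum of M, and d at p_d is a linearization. *)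

(** * Orders compatible with two interval orders *)

Lemma exists_argmin (T : eqType) (f : T -> nat) (s : seq T) :
  s != [::] -> exists2 a, a \in s & {in s, forall b, f a <= f b}.
Proof.
elim: s => // x s IHs _; have [->|s_neq0] := eqVneq s [::].
  by exists x => [|b]; rewrite ?inE // => /eqP->.
have [a a_s a_min] := IHs s_neq0; have [le_xa|lt_ax] := leqP (f x) (f a).
  exists x => [|b]; rewrite inE ?eqxx // => /predU1P[->//|/a_min].
  exact: leq_trans.
exists a => [|b]; rewrite inE ?a_s ?orbT // => /predU1P[->|/a_min//].
exact: ltnW.
Qed.

(* If [a] minimizes [u1] and [b] minimizes [u2], then one of [a], [b] may come
   first: otherwise [u1 a < l1 b] and [u2 b < l2 a]. *)
Lemma two_interval_order (T : eqType) (l1 u1 l2 u2 : T -> nat) (s : seq T) :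
    {in s, forall x, l1 x <= u1 x} -> {in s, forall x, l2 x <= u2 x} ->
    {in s &, forall x y, u1 x < l1 y -> l2 x <= u2 y} ->
  exists2 xs, perm_eq xs s &
    pairwise (fun x y => (l1 x <= u1 y) && (l2 x <= u2 y)) xs.
Proof.
have [n] := ubnP (size s); elim: n s => // n IHn s le_s_n le1 le2 le12.
have [->|s_neq0] := eqVneq s [::]; first by exists [::].
have [a a_s a_min] := exists_argmin u1 s_neq0.
have [b b_s b_min] := exists_argmin u2 s_neq0.
have [x x_s xP]: exists2 x, x \in s &
    {in s, forall y, (l1 x <= u1 y) && (l2 x <= u2 y)}.
  have [le_ba|lt_ab] := leqP (l1 b) (u1 a).
    exists b => // y ys; rewrite (leq_trans le_ba) ?a_min //=.
    by rewrite (leq_trans (le2 _ b_s)) ?b_min.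
  exists a => // y ys; rewrite (leq_trans (le1 _ a_s)) ?a_min //=.
  by rewrite (leq_trans (le12 _ _ a_s b_s lt_ab)) ?b_min.
have rem_s y : y \in rem x s -> y \in s by apply: mem_rem.
have [|y /rem_s /le1|y /rem_s /le2|y z /rem_s ys /rem_s zs|xs perm_xs xsP] //
  := IHn (rem x s).
- by rewrite size_rem // -ltnS prednK //; case: (s) x_s.
- exact: le12.
exists (x :: xs); first by rewrite perm_sym (permPl (perm_to_rem x_s)) perm_cons perm_sym.
rewrite /= xsP andbT; apply/allP => y; rewrite (perm_mem perm_xs) => /rem_s.
exact: xP.
Qed.

(** * Running maxima and prefixes of monotone sequences *)

Definition runmax (T : eqType) (f : T -> nat) (xs : seq T) (x : T) : nat :=
  \max_(y <- take (index x xs).+1 xs) f y.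

Lemma runmax_leP (T : eqType) (f : T -> nat) (xs : seq T) (x : T) (m : nat) :
  reflect {in take (index x xs).+1 xs, forall y, f y <= m} (runmax f xs x <= m).
Proof.
by apply: (iffP (bigmax_leqP_seq _ _ _ _)) => le_m y => [/le_m->|/le_m].
Qed.

Lemma leq_runmax (T : eqType) (f : T -> nat) (xs : seq T) (x : T) :
  x \in xs -> f x <= runmax f xs x.
Proof.
by move=> x_xs; move/runmax_leP: (leqnn (runmax f xs x)); apply; rewrite in_take.
Qed.

(** Keeps a point placed at a running maximum before its deadline [u x]: earlier elements are
    bounded by the pairwise condition, [x] itself by the pointwise one. *)
Lemma runmax_pairwise (T : eqType) (f u : T -> nat) (xs : seq T) :
    uniq xs -> {in xs, forall x, f x <= u x} ->
    pairwise (fun x y => f x <= u y) xs ->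
  {in xs, forall x, runmax f xs x <= u x}.
Proof.
move=> uniq_xs le_xs pw x x_xs; apply/runmax_leP => y y_x.
have y_xs := mem_take y_x; move: y_x; rewrite in_take // ltnS leq_eqVlt.
case/predU1P => [|lt_yx]; last first.
  move/(pairwiseP x): pw => /(_ (index y xs) (index x xs)).
  by rewrite !inE !index_mem !nth_index //; apply.
by move/(congr1 (nth x xs)); rewrite !nth_index // => ->; apply: le_xs.
Qed.

Lemma runmax_sorted (T : eqType) (f : T -> nat) (xs : seq T) :
  uniq xs -> pairwise (fun x y => runmax f xs x <= runmax f xs y) xs.
Proof.
move=> uniq_xs; case: xs uniq_xs => // x0 xs'; set xs := x0 :: xs' => uniq_xs.
apply/(pairwiseP x0) => i j lti ltj lt_ij; apply/runmax_leP => y y_i.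
apply: (runmax_leP _ _ _ _ (leqnn _)); move: y_i; rewrite !index_uniq //.
have -> : j.+1 = i.+1 + (j - i) by lia.
by rewrite takeD mem_cat => ->.
Qed.

(** Once [p] fails along [s] it fails for the rest, so [p] cuts out a prefix. *)
Lemma filter_cat_closed (T : Type) (p : pred T) (s : seq T) :
  pairwise (fun x y => p y ==> p x) s ->
  s = [seq x <- s | p x] ++ [seq x <- s | ~~ p x].
Proof.
elim: s => //= x s IHs /andP[all_x /IHs def_s].
case: ifP => [_|/negbT npx] /=; first by rewrite -def_s.
have all_npx: all (predC p) s.
  by apply: sub_all all_x => y /=; rewrite (negPf npx) implybF.
rewrite (all_filterP all_npx) (_ : [seq y <- s | p y] = [::]) //.
by apply/size0nil/eqP; rewrite size_filter -leqn0 leqNgt -has_count -all_predC.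
Qed.

Lemma filter_ltnS (T : Type) (g : T -> nat) (t : nat) (s : seq T) :
  pairwise (fun x y => g x <= g y) s ->
  [seq x <- s | g x < t.+1] = [seq x <- s | g x < t] ++ [seq x <- s | g x == t].
Proof.
move=> g_mono; rewrite (@filter_cat_closed _ (fun x => g x < t) [seq x <- s | g x < t.+1]).
  rewrite -!filter_predI; congr (_ ++ _); apply: eq_filter => x /=; lia.
apply: pairwise_filter; apply: sub_pairwise g_mono => x y le_xy.
by apply/implyP; apply: leq_ltn_trans.
Qed.

(** * Runs of the queue and legality of a schedule *)

Definition enq_val (e : event) : option nat :=
  if op_of e is Enq x then Some x else None.

Definition deq_val (e : event) : option nat :=
  if op_of e is Deq v then v else None.

Lemma lts_run_cat q s q' s' q'' :
  lts_run q s q' -> lts_run q' s' q'' -> lts_run q (s ++ s') q''.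
Proof. by elim=> // {}q e q1 {}s q2 st _ IH /IH; apply: run_cons. Qed.

Lemma lts_run_enqs q ys (ev : nat -> event) :
  (forall y, y \in ys -> op_of (ev y) = Enq y) ->
  lts_run q (map ev ys) (q ++ ys).
Proof.
elim: ys q => [|y ys IHys] q ev_ys; first by rewrite cats0; constructor.
apply: (@run_cons _ _ (rcons q y)); first by rewrite ev_ys ?mem_head; constructor.
by rewrite -cat_rcons; apply: IHys => z z_ys; rewrite ev_ys ?inE ?z_ys ?orbT.
Qed.

Lemma lts_run_deqs q ys (ev : nat -> event) :
  (forall y, y \in ys -> op_of (ev y) = Deq (Some y)) ->
  lts_run (ys ++ q) (map ev ys) q.
Proof.
elim: ys => [|y ys IHys] ev_ys; first by constructor.
apply: (@run_cons _ _ (ys ++ q)); first by rewrite ev_ys ?mem_head; constructor.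
by apply: IHys => z z_ys; rewrite ev_ys ?inE ?z_ys ?orbT.
Qed.

Lemma lts_run_nulls s :
  (forall e, e \in s -> op_of e = Deq None) -> lts_run [::] s [::].
Proof.
elim: s => [|e s IHs] s_null; first by constructor.
apply: (@run_cons _ _ [::]); first by rewrite s_null ?mem_head; constructor.
by apply: IHs => d d_s; rewrite s_null ?inE ?d_s ?orbT.
Qed.

Definition point (pn : event -> nat) (pe pd : nat -> nat) (e : event) : nat :=
  match op_of e with
  | Enq x => pe x
  | Deq (Some x) => pd x
  | Deq None => pn e
  end.

(* At equal points, NULL dequeues come first and enqueues precede dequeues. *)
Definition schedule (pn : event -> nat) (pe pd : nat -> nat)
    (nulls enqs deqs : seq event) : seq event :=
  sort (relpre (point pn pe pd) leq) (nulls ++ enqs ++ deqs).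

(** Induction on time: after the events with points below [t], the queue holds, in the order of
    [xs], the values [x] with [pe x < t <= pd x]. The bound [N] plays infinity: a value never
    dequeued has [pd x >= N]. *)
Lemma legal_schedule (pn : event -> nat) (pe pd : nat -> nat)
    (nulls : seq event) (xs : seq nat) (dequeued : pred nat)
    (enq_ev deq_ev : nat -> event) (N : nat) :
    (forall x, op_of (enq_ev x) = Enq x) ->
    (forall x, op_of (deq_ev x) = Deq (Some x)) ->
    {in nulls, forall d, op_of d = Deq None} ->
    pairwise (fun x y => pe x <= pe y) xs ->
    pairwise (fun x y => pd x <= pd y) xs ->
    {in xs, forall x, pe x <= pd x} ->
    {in nulls & xs, forall d x, pe x < pn d -> pd x < pn d} ->
    {in xs, forall x, ~~ dequeued x -> N <= pd x} ->
    {in nulls, forall d, pn d < N} -> {in xs, forall x, pe x < N} ->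
    {in xs, forall x, dequeued x -> pd x < N} ->
  legal (schedule pn pe pd nulls (map enq_ev xs)
           (map deq_ev [seq x <- xs | dequeued x])).
Proof.
move=> enq_evE deq_evE nullsE pe_mono pd_mono le_pe_pd null_ok undeq nullN peN pdN.
set s := schedule _ _ _ _ _ _; pose pt := point pn pe pd.
have pt_mono: pairwise (fun e e' => pt e <= pt e') s.
  rewrite -(sorted_pairwise (fun x y z => @leq_trans (pt x) (pt y) (pt z))).
  by apply: sort_sorted => x y; apply: leq_total.
have blockE t : t < N -> [seq e <- s | pt e == t] =
    [seq d <- nulls | pn d == t] ++ map enq_ev [seq x <- xs | pe x == t]
      ++ map deq_ev [seq x <- xs | pd x == t].
  (* Sorting is stable, so the events at instant [t] keep their order from the unsorted list: NULL
     dequeues, enqueues, dequeues. *)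
  move=> ltN; rewrite filter_sort; last 2 first.
  - by move=> x y; apply: leq_total.
  - by move=> x y z; apply: leq_trans.
  rewrite pairwise_sort; last first.
    apply/(pairwiseP (0, Enq 0)) => i j lti ltj _ /=.
    have all_t := filter_all (fun e => pt e == t) (nulls ++ map enq_ev xs ++
      map deq_ev [seq x <- xs | dequeued x]).
    by rewrite -!/pt (eqP (all_nthP _ all_t _ lti)) (eqP (all_nthP _ all_t _ ltj)).
  rewrite !filter_cat !filter_map -filter_predI; congr (_ ++ _); last congr (_ ++ _).
  - by apply: eq_in_filter => d /nullsE; rewrite /pt /point => ->.
  - by congr map; apply: eq_in_filter => x _ /=; rewrite /pt /point enq_evE.
  - congr map; apply: eq_in_filter => x x_xs /=; rewrite /pt /point deq_evE.
    have := undeq x x_xs; case: (dequeued x); rewrite ?andbT ?andbF //.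
    by move/(_ isT); case: eqP => // ->; rewrite leqNgt ltN.
have run t : t <= N -> lts_run [::] [seq e <- s | pt e < t]
    [seq x <- xs | pe x < t <= pd x].
  elim: t => [|t IHt] ltN.
    by rewrite !(eq_filter (a2 := pred0)) ?filter_pred0 //; constructor.
  rewrite filter_ltnS //; apply: lts_run_cat (IHt (ltnW ltN)) _.
  rewrite blockE //.
  apply: (@lts_run_cat _ _ [seq x <- xs | pe x < t <= pd x]).
    have in_null d: d \in [seq d <- nulls | pn d == t] -> pn d = t /\ d \in nulls.
      by rewrite mem_filter => /andP[/eqP].
    move: in_null; case: [seq d <- nulls | pn d == t] => [|d ds] in_null.
      by constructor.
    have [pn_d d_null] := in_null d (mem_head _ _).
    (* A NULL dequeue at [t] finds the queue empty: values enqueued before [t] have left it before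
       [t]. *)
    have -> : [seq x <- xs | pe x < t <= pd x] = [::].
      apply/size0nil/eqP; rewrite size_filter -leqn0 leqNgt -has_count.
      apply/hasPn => x x_xs; rewrite -pn_d; apply/negP => /andP[lt_pe].
      by rewrite leqNgt null_ok.
    by apply: lts_run_nulls => d' /in_null[_ /nullsE].
  apply: lts_run_cat; first by apply: lts_run_enqs => y _; apply: enq_evE.
  (* Both sides list the [x] with [pe x <= t <= pd x] in the order of [xs]; the values dequeued at
     [t] come first because [pd] is monotone along [xs]. *)
  have -> : [seq x <- xs | pe x < t <= pd x] ++ [seq x <- xs | pe x == t] =
      [seq x <- xs | pd x == t] ++ [seq x <- xs | pe x < t.+1 <= pd x].
    pose ys := [seq x <- xs | t <= pd x].
    transitivity [seq x <- ys | pe x < t.+1].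
      rewrite (@filter_ltnS _ pe t ys) ?pairwise_filter // -!filter_predI.
      by congr (_ ++ _); apply: eq_in_filter => x /le_pe_pd /= le_x; lia.
    rewrite (@filter_cat_closed _ (fun x => pd x < t.+1) (filter _ ys)).
      rewrite -!filter_predI; congr (_ ++ _); apply: eq_in_filter;
        by move=> x /le_pe_pd /= le_x; lia.
    do 2!apply: pairwise_filter; apply: sub_pairwise pd_mono => x y le_xy.
    by apply/implyP; apply: leq_ltn_trans.
  by apply: lts_run_deqs => y _; apply: deq_evE.
exists [seq x <- xs | pe x < N <= pd x].
have -> : s = [seq e <- s | pt e < N]; last exact: run.
apply/esym/all_filterP/allP => e; rewrite mem_sort !mem_cat.
case/or3P => [e_null|/mapP[x x_xs ->]|/mapP[x]].
- by rewrite /pt /point nullsE ?nullN.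
- by rewrite /pt /point enq_evE peN.
- by rewrite mem_filter => /andP[dq_x x_xs] ->; rewrite /pt /point deq_evE pdN.
Qed.

(** * From intervals to a linearization *)

Lemma uniq_pmap (T U : eqType) (f : T -> option U) (s : seq T) :
    uniq s -> {in s &, forall x y, f x = f y -> f x -> x = y} ->
  uniq (pmap f s).
Proof.
move=> uniq_s f_inj.
have /map_inj_uniq<- : injective (@Some U) by move=> x y [].
rewrite pmapS_filter map_inj_in_uniq ?filter_uniq // => x y.
by rewrite !mem_filter => /andP[fx xs] /andP[_ ys] /f_inj->.
Qed.

(* [I e] and [O e] are the instants of the invocation and of the response of [e],
   and [p d] is an instant at which the NULL dequeue [d] may take effect. *)
Lemma linearization_of_intervals (E : seq event) (I O p : event -> nat) :
    uniq E -> {in E, forall e, I e <= O e} ->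
    {in E &, forall e e', op_of e = op_of e' -> op_of e != Deq None -> e = e'} ->
    {in E, forall d x, op_of d = Deq (Some x) ->
       exists e, [/\ e \in E, op_of e = Enq x & I e <= O d]} ->
    {in E & &, forall ex ey dx x y, op_of ex = Enq x -> op_of ey = Enq y ->
       op_of dx = Deq (Some x) -> O ey < I ex ->
       exists dy, [/\ dy \in E, op_of dy = Deq (Some y) & I dy <= O dx]} ->
    {in E, forall d, op_of d = Deq None ->
       [/\ I d <= p d, p d <= O d, {in E, forall e, I e != p d} &
         {in E, forall e x, op_of e = Enq x -> O e < p d ->
            exists d', [/\ d' \in E, op_of d' = Deq (Some x) & I d' < p d]}]} ->
  exists s, [/\ perm_eq s E, legal s &
    {in s &, forall e e', O e < I e' -> index e s < index e' s}].
Proof.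
move=> uniqE leIO op_inj fresh ord wit.
(* The event of [E] with operation [o], unique unless [o] is [Deq None]. The default [(0, o)] makes
   [evE] hold for every [o]. *)
pose ev o := nth (0, o) E (index o (map op_of E)).
have evE o : op_of (ev o) = o.
  have [oE|oE] := boolP (o \in map op_of E); last first.
    by rewrite /ev nth_default // -(size_map op_of) leqNgt index_mem.
  by rewrite /ev -(nth_map _ o) ?nth_index // -(size_map op_of) index_mem.
have ev_in o : o \in map op_of E -> ev o \in E.
  by move=> oE; rewrite mem_nth // -(size_map op_of) index_mem.
have ev_op e : e \in E -> op_of e != Deq None -> ev (op_of e) = e.
  by move=> eE e_null; apply/esym/op_inj; rewrite ?evE // ev_in ?map_f.
(* [N] lies after every response and stands for infinity in [Id] and [Od]. *)
pose N := (\max_(e <- E) O e).+1.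
have O_N e : e \in E -> O e < N by move=> eE; rewrite ltnS leq_bigmax_seq.
pose dq x := Deq (Some x) \in map op_of E.
pose vals := pmap enq_val E.
have valsP x : (x \in vals) = (Enq x \in map op_of E).
  rewrite mem_pmap; apply/mapP/mapP => -[e eE]; rewrite /enq_val.
    by case def_e: (op_of e) => [y|//] [->]; exists e.
  by move=> def_e; exists e; rewrite // -def_e.
have uniq_vals: uniq vals.
  apply: uniq_pmap => // e e' eE e'E; rewrite /enq_val.
  case ope: (op_of e) => [x|//]; case ope': (op_of e') => [y|//] [eq_xy] _.
  by apply: op_inj; rewrite ?ope ?ope' ?eq_xy.
have enq_ev_in x : x \in vals -> ev (Enq x) \in E by rewrite valsP; apply: ev_in.
pose Ie x := I (ev (Enq x)); pose Oe x := O (ev (Enq x)).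
pose Id x := if dq x then I (ev (Deq (Some x))) else N.
pose Od x := if dq x then O (ev (Deq (Some x))) else N.
pose M x := maxn (Ie x) (Id x).
pose nulls := [seq d <- E | op_of d == Deq None].
have in_nulls d : d \in nulls -> d \in E /\ op_of d = Deq None.
  by rewrite mem_filter => /andP[/eqP].
(* A value that is not both enqueued and dequeued before the point of a NULL
   dequeue has to be enqueued after it. *)
pose Le x := maxn (Ie x) (\max_(d <- nulls | p d < M x) p d).
have Le_p x d : d \in nulls -> p d < M x -> p d <= Le x.
  by move=> d_null lt_p; rewrite leq_max leq_bigmax_seq ?orbT.
have LeP x m : Le x <= m <-> Ie x <= m /\ {in nulls, forall d, p d < M x -> p d <= m}.
  rewrite geq_max; split=> [/andP[-> /bigmax_leqP_seq le_m]|[-> le_m]] //.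
  exact/bigmax_leqP_seq.
have leIOe x : x \in vals -> Ie x <= Oe x by move/enq_ev_in/leIO.
have freshE x : dq x -> x \in vals /\ Ie x <= Od x.
  move=> dq_x; have [e [eE ope le_e]] := fresh _ (ev_in _ dq_x) x (evE _).
  rewrite valsP -ope map_f // /Od dq_x; split=> //.
  by rewrite /Ie -ope ev_op ?ope.
have leIOd x : x \in vals -> Id x <= Od x.
  by rewrite /Id /Od; case: ifP => // dq_x _; rewrite leIO ?ev_in.
have leMO x : x \in vals -> M x <= Od x.
  move=> x_val; rewrite geq_max leIOd // andbT.
  case dq_x: (dq x); first by have [] := freshE x dq_x.
  by rewrite /Od dq_x (leq_trans (leIOe x x_val)) // ltnW ?O_N ?enq_ev_in.
have OdN x : Od x <= N.
  by rewrite /Od; case: ifP => // dq_x; rewrite ltnW ?O_N ?ev_in.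
have M_neq x d : x \in vals -> d \in nulls -> M x != p d.
  move=> x_val /in_nulls[dE opd]; have [_ p_O I_neq _] := wit d dE opd.
  have p_N: p d < N by apply: leq_ltn_trans p_O (O_N d dE).
  rewrite /M /maxn; case: ifP => _; last by rewrite I_neq ?enq_ev_in.
  by rewrite /Id; case: ifP => [dq_x|_]; [rewrite I_neq ?ev_in | rewrite gtn_eqF].
have witM x d : x \in vals -> d \in nulls -> Oe x < p d -> dq x /\ M x < p d.
  move=> x_val /in_nulls[dE opd] lt_O; have [_ p_O _ dq_p] := wit d dE opd.
  have [d' [d'E opd' lt_I]] := dq_p _ (enq_ev_in x x_val) x (evE _) lt_O.
  have dq_x: dq x by rewrite /dq -opd' map_f.
  split=> //; rewrite gtn_max (leq_ltn_trans (leIOe x x_val) lt_O) /Id dq_x.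
  by rewrite -opd' ev_op ?opd'.
(* If [Oe x < p d] for a NULL dequeue [d], then [witM] gives [M x < p d], so [p d] does not count in
   [Le x]. *)
have leLO x : x \in vals -> Le x <= Oe x.
  move=> x_val; apply/LeP; split=> [|d d_null lt_p]; first exact: leIOe.
  rewrite leqNgt; apply/negP => /(witM x d x_val d_null)[_].
  by rewrite ltnNge ltnW.
(* Suppose [Od y < M x]. If [Oe x < Ie y], the condition [ord] yields a dequeue of [x] invoked by
   [Od y], whence [M x <= Od y]. If [Oe x < p d] with [p d < M y], then [M x < p d < M y <= Od y].
   Both are absurd. *)
have no_cycle : {in vals &, forall x y, Oe x < Le y -> M x <= Od y}.
  move=> x y x_val y_val; rewrite ltnNge => /negP nle_Le.
  rewrite leqNgt; apply/negP => lt_M; apply: nle_Le.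
  have dq_y : dq y.
    apply: contraLR lt_M => ndq_y; rewrite -leqNgt /Od (negPf ndq_y).
    by apply: leq_trans (leMO x x_val) (OdN x).
  apply/LeP; split=> [|d d_null lt_p].
    rewrite leqNgt; apply/negP => lt_OI.
    have dy_E : ev (Deq (Some y)) \in E by apply: ev_in.
    have [dx [dxE opdx le_I]] := ord _ _ _ (enq_ev_in y y_val) (enq_ev_in x x_val) dy_E
      y x (evE _) (evE _) (evE _) lt_OI.
    have [_ le_IO] := freshE y dq_y.
    have dq_x: dq x by rewrite /dq -opdx map_f.
    have le_IdO: Id x <= Od y by rewrite /Id /Od dq_x dq_y -opdx ev_op ?opdx.
    have := leIOe x x_val; move: lt_M lt_OI le_IO le_IdO; rewrite /M -/(Oe x) -/(Ie y); lia.
  rewrite leqNgt; apply/negP => /(witM x d x_val d_null)[_ lt_Mp].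
  have := leMO y y_val; lia.
have [xs perm_xs pw_xs] := two_interval_order leLO leMO no_cycle.
have xsP : xs =i vals by apply: perm_mem.
have uniq_xs : uniq xs by rewrite (perm_uniq perm_xs).
pose pe := runmax Le xs; pose pd := runmax M xs.
have le_Le_pe x : x \in vals -> Le x <= pe x by rewrite -xsP; apply: leq_runmax.
have le_M_pd x : x \in vals -> M x <= pd x by rewrite -xsP; apply: leq_runmax.
have le_pe_Oe x : x \in vals -> pe x <= Oe x.
  rewrite -xsP; apply: runmax_pairwise => // [y|]; first by rewrite xsP => /leLO.
  by apply: sub_pairwise pw_xs => y z /andP[].
have le_pd_Od x : x \in vals -> pd x <= Od x.
  rewrite -xsP; apply: runmax_pairwise => // [y|]; first by rewrite xsP => /leMO.
  by apply: sub_pairwise pw_xs => y z /andP[].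
have le_Le_M x : Le x <= M x.
  by apply/LeP; split=> [|d _ /ltnW//]; rewrite leq_maxl.
pose pt := point p pe pd.
have leIpt e : e \in E -> I e <= pt e.
  move=> eE; rewrite /pt /point; case ope: (op_of e) => [x|[x|]].
  - have x_val: x \in vals by rewrite valsP -ope map_f.
    by apply: leq_trans (le_Le_pe x x_val); rewrite leq_max /Ie -ope ev_op ?ope ?leqnn.
  - have dq_x: dq x by rewrite /dq -ope map_f.
    have [x_val _] := freshE x dq_x; apply: leq_trans (le_M_pd x x_val).
    by rewrite leq_max /Id dq_x -ope ev_op ?ope ?leqnn ?orbT.
  - by have [] := wit e eE ope.
have leptO e : e \in E -> pt e <= O e.
  move=> eE; rewrite /pt /point; case ope: (op_of e) => [x|[x|]].
  - have x_val: x \in vals by rewrite valsP -ope map_f.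
    by apply: leq_trans (le_pe_Oe x x_val) _; rewrite /Oe -ope ev_op ?ope.
  - have dq_x: dq x by rewrite /dq -ope map_f.
    have [x_val _] := freshE x dq_x; apply: leq_trans (le_pd_Od x x_val) _.
    by rewrite /Od dq_x -ope ev_op ?ope.
  - by have [] := wit e eE ope.
pose enq_ev x := ev (Enq x); pose deq_ev x := ev (Deq (Some x)).
pose s := schedule p pe pd nulls (map enq_ev xs) (map deq_ev [seq x <- xs | dq x]).
have perm_sE : perm_eq s E.
  rewrite perm_sort; apply: uniq_perm => // [|e].
    rewrite !cat_uniq filter_uniq // !map_inj_in_uniq ?filter_uniq ?uniq_xs //=.
    - rewrite has_cat negb_or andbT -andbA; apply/and3P; split.
      + by apply/hasPn => _ /mapP[x _ ->]; rewrite mem_filter evE.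
      + by apply/hasPn => _ /mapP[x _ ->]; rewrite mem_filter evE.
      + apply/hasPn => _ /mapP[x _ ->]; apply/mapP => -[y _].
        by move/(congr1 op_of); rewrite !evE.
    - by move=> x y _ _ /(congr1 op_of); rewrite !evE => -[].
    - by move=> x y _ _ /(congr1 op_of); rewrite !evE => -[].
  rewrite !mem_cat mem_filter; apply/or3P/idP => [|eE].
    case=> [/andP[]//|/mapP[x]|/mapP[x]]; rewrite ?mem_filter.
      by rewrite xsP => /enq_ev_in ? ->.
    by case/andP=> dq_x _ ->; rewrite ev_in.
  case ope: (op_of e) => [x|[x|]].
  - apply: Or32; apply/mapP; exists x; first by rewrite xsP valsP -ope map_f.
    by rewrite /enq_ev -ope ev_op ?ope.
  - have dq_x: dq x by rewrite /dq -ope map_f.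
    have [x_val _] := freshE x dq_x; apply: Or33; apply/mapP; exists x.
      by rewrite mem_filter dq_x xsP.
    by rewrite /deq_ev -ope ev_op ?ope.
  - by apply: Or31; rewrite eqxx.
exists s; split=> //.
  apply: (@legal_schedule _ _ _ _ _ _ _ _ N).
  - by move=> x; apply: evE.
  - by move=> x; apply: evE.
  - by move=> d /in_nulls[].
  - exact: runmax_sorted.
  - exact: runmax_sorted.
  - move=> x x_xs; apply/runmax_leP => y y_x; apply: leq_trans (le_Le_M y) _.
    exact: (runmax_leP _ _ _ _ (leqnn _)).
  - move=> d x d_null x_xs.
    move=> lt_pe; rewrite ltnNge; apply/negP => le_p.
    (* For [y] up to [x] in [xs], [p d < M y] would give [p d <= Le y <= pe x < p d]; equality is
       excluded by [M_neq], so [M y < p d]. *)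
    have: pd x <= (p d).-1; last by lia.
    apply/runmax_leP => y y_x.
    have y_val: y \in vals by rewrite -xsP (mem_take y_x).
    have := runmax_leP _ _ _ _ (leqnn (pe x)) y y_x.
    by have := M_neq y d y_val d_null; have := Le_p y d d_null; lia.
  - move=> x; rewrite xsP => /le_M_pd; rewrite /M /Id => le_pd /negPf ndq_x.
    by rewrite (leq_trans _ le_pd) // ndq_x leq_maxr.
  - move=> d /in_nulls[dE opd]; have [_ p_O _ _] := wit d dE opd.
    exact: leq_ltn_trans p_O (O_N d dE).
  - move=> x; rewrite xsP => x_val.
    by apply: leq_ltn_trans (le_pe_Oe x x_val) _; rewrite O_N ?enq_ev_in.
  - move=> x; rewrite xsP => x_val dq_x.
    by apply: leq_ltn_trans (le_pd_Od x x_val) _; rewrite /Od dq_x O_N ?ev_in.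
move=> e e' e_s e'_s lt_OI.
have eE: e \in E by rewrite -(perm_mem perm_sE).
have e'E: e' \in E by rewrite -(perm_mem perm_sE).
(* Each point lies in the interval of its event, so disjoint intervals have points in the same
   order. *)
have lt_pt: pt e < pt e'.
  exact: leq_ltn_trans (leptO e eE) (leq_trans lt_OI (leIpt e' e'E)).
rewrite ltnNge leq_eqVlt; apply/negP => /predU1P[/index_inj eq_e|lt_e].
  by move: lt_pt; rewrite eq_e ?ltnn.
have pt_trans: transitive (relpre pt leq) by move=> x y z; apply: leq_trans.
have pt_total: total (relpre pt leq) by move=> x y; apply: leq_total.
have := sorted_ltn_index pt_trans (sort_sorted pt_total _) _ _ e'_s e_s lt_e.
by rewrite /= leqNgt lt_pt.
Qed.

(** * Actions, events and completions of a history *)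

Lemma is_inv_inv e : is_inv (inv e).
Proof. by rewrite /inv; case: (op_of e). Qed.

Lemma is_res_res e : is_res (res e).
Proof. by rewrite /res; case: (op_of e). Qed.

Lemma act_uid_inv e : act_uid (inv e) = uid e.
Proof. by rewrite /inv; case: (op_of e). Qed.

Lemma act_uid_res e : act_uid (res e) = uid e.
Proof. by rewrite /res; case: (op_of e). Qed.

Lemma res_neq_inv e e' : (res e == inv e') = false.
Proof.
by apply/eqP => eq_a; have := is_res_res e; rewrite eq_a /is_res is_inv_inv.
Qed.

(** Both actions are needed: the invocation of a dequeue hides its value, the response of an enqueue
    hides its input. *)
Lemma inv_res_inj e e' : inv e = inv e' -> res e = res e' -> e = e'.
Proof.
case: e e' => [u [x|v]] [u' [x'|v']]; rewrite /inv /res //=; first by move=> [-> ->].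
by move=> [->] [->].
Qed.

Lemma uniq_map_filter_inj (T U : eqType) (f : T -> U) (p : pred T) (s : seq T) :
  uniq [seq f x | x <- s & p x] -> {in s &, forall x y, p x -> p y -> f x = f y -> x = y}.
Proof.
move=> uniq_fs x y xs ys px py eq_f.
have x_ps: x \in [seq z <- s | p z] by rewrite mem_filter px.
have y_ps: y \in [seq z <- s | p z] by rewrite mem_filter py.
rewrite -(nth_index x x_ps) -(nth_index x y_ps); congr nth; apply/eqP.
rewrite -(nth_uniq (f x) _ _ uniq_fs) ?size_map ?index_mem //.
by rewrite !(nth_map x) ?index_mem ?nth_index ?eq_f.
Qed.

Lemma mem_split (T : eqType) (x : T) (s : seq T) :
  x \in s -> exists s1 s2, s = s1 ++ x :: s2.
Proof. by case/path.splitPr=> s1 s2; exists s1, s2. Qed.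

Lemma index_uniq_pivot (T : eqType) (x : T) (s1 s2 : seq T) :
  uniq (s1 ++ x :: s2) -> index x (s1 ++ x :: s2) = size s1.
Proof.
rewrite uniq_catC /= mem_cat negb_or => /andP[/andP[_ /negPf x_s1] _].
by rewrite index_cat x_s1 /= eqxx addn0.
Qed.

Lemma mem2_index (T : eqType) (s : seq T) (x y : T) :
  uniq s -> y \in s -> mem2 s x y = (index x s <= index y s).
Proof.
move=> uniq_s ys; rewrite /mem2 leqNgt -in_take //.
move: uniq_s ys; rewrite -{1 2}(cat_take_drop (index x s) s) cat_uniq mem_cat.
case/and3P=> _ /hasPn disj _ /orP[y_take|y_drop]; last by rewrite y_drop disj.
by rewrite y_take; apply: contraTF y_take => /disj.
Qed.

Lemma history_uniq c : history c -> uniq c.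
Proof.
case=> /map_uniq uniq_inv /map_uniq uniq_res _.
rewrite -(perm_uniq (permEl (perm_filterC is_inv c))) cat_uniq.
apply/and3P; split=> //; apply/hasPn => a.
by rewrite !mem_filter /= => /andP[/negPf->].
Qed.

Lemma completed_uid_inj c e e' :
  history c -> completed c e -> completed c e' -> uid e = uid e' -> e = e'.
Proof.
case=> uniq_inv uniq_res _ /andP[ie re] /andP[ie' re'] eq_u; apply: inv_res_inj.
  by apply: (uniq_map_filter_inj uniq_inv); rewrite ?is_inv_inv ?act_uid_inv.
by apply: (uniq_map_filter_inj uniq_res); rewrite ?is_res_res ?act_uid_res.
Qed.

(** A history only promises that some event with response [res e] was invoked earlier; uniqueness of
    invocation identifiers shows that its invocation is [inv e]. *)
Lemma index_inv_res c e :
  history c -> completed c e -> index (inv e) c < index (res e) c.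
Proof.
move=> hist_c /andP[ie re]; have := history_uniq hist_c.
case: (hist_c) => uniq_inv _ before.
have [c0 [c1 def_c]] := mem_split re.
have [e' eq_res ie'] := before c0 _ c1 def_c (is_res_res e).
have eq_inv: inv e' = inv e.
  apply: (uniq_map_filter_inj uniq_inv); rewrite ?is_inv_inv //.
    by rewrite def_c mem_cat ie'.
  by rewrite !act_uid_inv -!act_uid_res eq_res.
rewrite def_c => /index_uniq_pivot->.
by rewrite index_cat -eq_inv ie' index_mem.
Qed.

Lemma hb_index c e e' :
  history c -> inv e' \in c -> hb c e e' = (index (res e) c < index (inv e') c).
Proof.
move=> hist_c ie'; rewrite /hb mem2_index ?history_uniq // leq_eqVlt.
case: eqP => //= /esym eq_i; suff: res e == inv e' by rewrite res_neq_inv.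
by apply/eqP/esym/(index_inj (inv e') ie' _ eq_i); rewrite -index_mem -eq_i index_mem.
Qed.

(** A first appended response would answer an invocation of [c] that already has a response in [c],
    so nothing is appended, and nothing is pending to be deleted. *)
Lemma compl_complete c hc : complete c -> compl c hc -> hc = c.
Proof.
move=> complete_c [_ _ [c' [/allP res_c' [_ uniq_res before] ->]]].
suff /nilP-> : nilp c'.
  by rewrite cats0; apply/all_filterP/allP => a _; apply: complete_c.
case: c' res_c' uniq_res before => // a c' res_c'; have res_a := res_c' a (mem_head _ _).
rewrite filter_cat map_cat cat_uniq => /and3P[_ /hasPn disj _] before.
have [e eq_a ie] := before c a c' erefl res_a.
have := complete_c (uid e); rewrite /pending negb_and negbK => /orP[/hasPn/(_ _ ie)|].
  by rewrite is_inv_inv act_uid_inv eqxx.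
case/hasP=> b b_c /andP[res_b /eqP uid_b].
move/(_ (act_uid a)): disj; rewrite /= res_a mem_head => /(_ isT)/negP[].
by apply/mapP; exists b; rewrite ?mem_filter ?res_b // uid_b eq_a act_uid_res.
Qed.

Lemma compl_refl c : history c -> complete c -> compl c c.
Proof.
move=> hist_c complete_c; split=> //; exists [::]; split; rewrite ?cats0 //.
by apply/esym/all_filterP/allP => a _; apply: complete_c.
Qed.

(** Each event is read off from the one of its two actions that determines it: the invocation of an
    enqueue, the response of a dequeue. *)
Definition event_of (a : action) : option event :=
  match a with
  | InvEnq u x => Some (u, Enq x)
  | ResDeq u v => Some (u, Deq v)
  | _ => None
  end.

Definition events (c : seq action) : seq event := pmap event_of c.

Lemma events_uniq c : uniq c -> uniq (events c).
Proof.
move=> uniq_c; apply: uniq_pmap => // a b _ _.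
by case: a b => [u x|u|u|u v] [u' x'|u'|u'|u' v'] //= [-> ->].
Qed.

(** The missing action exists: completeness supplies the response of an enqueue, the definition of a
    history the invocation of a dequeue. *)
Lemma mem_events c e : history c -> complete c -> (e \in events c) = completed c e.
Proof.
move=> [uniq_inv uniq_res before] complete_c.
have res_inv a : a \in c -> is_res a -> exists2 e, a = res e & inv e \in c.
  move=> ac res_a; have [c0 [c1 def_c]] := mem_split ac.
  have [e' -> ie'] := before c0 a c1 def_c res_a.
  by exists e'; rewrite // def_c mem_cat ie'.
rewrite mem_pmap; apply/mapP/andP => [[[u x|u|u|u v] ac //= [->]]|[ie re]].
- split; first exact: ac.
  have := complete_c u; rewrite /pending negb_and negbK => /orP[/hasPn/(_ _ ac)|].
    by rewrite /= eqxx.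
  case/hasP=> b bc /andP[res_b /eqP uid_b].
  have [e' eq_b ie'] := res_inv b bc res_b.
  have eq_inv: inv e' = InvEnq u x.
    apply: (uniq_map_filter_inj uniq_inv); rewrite ?is_inv_inv //=.
    by rewrite act_uid_inv -act_uid_res -eq_b.
  move: eq_b eq_inv bc; rewrite /res /inv; case: (op_of e') => // y -> [-> _].
  by [].
- have [e' eq_a ie'] := res_inv _ ac isT; split; last exact: ac.
  by move: eq_a ie'; rewrite /res /inv; case: (op_of e') => // v' [-> _].
case: e ie re => u [x|v] /= ie re; first by exists (InvEnq u x).
by exists (ResDeq u v).
Qed.

Lemma completed_enq_inj c e e' x :
    history c -> enqueued_once c -> completed c e -> completed c e' ->
  op_of e = Enq x -> op_of e' = Enq x -> e = e'.
Proof.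
move=> hist_c once comp_e comp_e' ope ope'.
apply: (completed_uid_inj hist_c comp_e comp_e').
have /andP[+ _] := comp_e; have /andP[+ _] := comp_e'.
by rewrite /inv ope ope' => ie' /once; apply.
Qed.

Lemma completed_op_inj c :
    history c -> enqueued_once c -> ~ VRepet c ->
  {in completed c &, forall e e', op_of e = op_of e' -> op_of e != Deq None -> e = e'}.
Proof.
move=> hist_c once no_repet e e' comp_e comp_e' eq_op.
case ope: (op_of e) eq_op => [x|[x|//]] /esym ope' _; last first.
  have [//|/eqP neq] := eqVneq e e'; case: no_repet.
  by exists x, e, e'.
exact: (completed_enq_inj hist_c once comp_e comp_e' ope ope').
Qed.

(** * Linearizable complete histories have no violation *)

Lemma lts_run_split q s1 e s2 q' :
  lts_run q (s1 ++ e :: s2) q' ->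
  exists q1 q2, [/\ lts_run q s1 q1, lts_step q1 (op_of e) q2 & lts_run q2 s2 q'].
Proof.
elim: s1 q => [|e1 s1 IHs1] q run_s; inversion run_s; subst.
  by exists q, q'0; split=> //; constructor.
have [q1 [q2 [run1 st run2]]] := IHs1 _ H4.
by exists q1, q2; split=> //; apply: run_cons run1.
Qed.

(** The FIFO discipline as one equation: from the empty queue, the values dequeued form a prefix of
    the values enqueued. *)
Lemma lts_run_fifo q s q' :
  lts_run q s q' -> q ++ pmap enq_val s = pmap deq_val s ++ q'.
Proof.
elim=> [{}q|{}q e q1 {}s q2 st _ IHs] /=; first by rewrite cats0.
rewrite /enq_val /deq_val; move: IHs; inversion st; subst => /= <- //.
by rewrite cat_rcons.
Qed.

Lemma mem_pmap_op (v : event -> option nat) (o : op) s x :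
    (forall e, v e = Some x -> op_of e = o) -> x \in pmap v s ->
  exists2 e, e \in s & op_of e = o.
Proof. by move=> vP; rewrite mem_pmap => /mapP[e es /esym/vP]; exists e. Qed.

Lemma enq_valP e x : enq_val e = Some x -> op_of e = Enq x.
Proof. by rewrite /enq_val; case: (op_of e) => // y [->]. Qed.

Lemma deq_valP e x : deq_val e = Some x -> op_of e = Deq (Some x).
Proof. by rewrite /deq_val; case: (op_of e) => // v ->. Qed.

Lemma pmap_index_ltn (T U : eqType) (f : T -> option U) (s : seq T) x y u v :
    uniq (pmap f s) -> x \in s -> y \in s -> f x = Some u -> f y = Some v ->
  index x s < index y s -> index u (pmap f s) < index v (pmap f s).
Proof.
move=> + xs ys fx fy; have [s1 [s2 def_s]] := mem_split xs; subst s.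
rewrite pmap_cat /= fx /= cat_uniq /= negb_or => /and4P[_ /andP[u_s1 /hasPn disj] u_s2 _].
have x_s1: x \notin s1 by apply: contra u_s1 => x_s1; rewrite mem_pmap -fx map_f.
move: ys; rewrite !index_cat (negPf x_s1) (negPf u_s1) /= !eqxx addn0 mem_cat inE.
have [y_s1|/= _] := boolP (y \in s1); first by rewrite ltnNge ltnW ?index_mem.
case: eqP => [->|_ /= y_s2 _]; first by rewrite eqxx addn0 ltnn.
have v_s2: v \in pmap f s2 by rewrite mem_pmap -fy map_f.
rewrite (negPf (disj v v_s2)) /=; case: eqP => [eq_uv|_]; last by lia.
by rewrite eq_uv v_s2 in u_s2.
Qed.

Lemma legal_complete_no_violation c s :
    history c -> complete c -> enqueued_once c -> ordering_of c s -> legal s ->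
    (forall e e', e \in s -> e' \in s -> hb c e e' -> index e s < index e' s) ->
  ~ (VFresh c \/ VRepet c \/ VOrd c \/ VWit c).
Proof.
move=> hist_c complete_c once [uniq_s sE] [qf run_s] hb_s.
have enq_inj e e' x : e \in s -> e' \in s -> op_of e = Enq x -> op_of e' = Enq x -> e = e'.
  by rewrite !sE; apply: completed_enq_inj.
have fifo := lts_run_fifo run_s; rewrite /= in fifo.
have uniq_enqs: uniq (pmap enq_val s).
  apply: uniq_pmap => // e e' es e's eq_v.
  case ve: (enq_val e) => [x|//] _; apply: (enq_inj e e' x) => //; apply: enq_valP => //.
  by rewrite -eq_v.
have uniq_deqs: uniq (pmap deq_val s).
  by move: uniq_enqs; rewrite fifo cat_uniq => /and3P[].
have deqE d x : op_of d = Deq (Some x) -> deq_val d = Some x.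
  by rewrite /deq_val => ->.
have enqE d x : op_of d = Enq x -> enq_val d = Some x.
  by rewrite /enq_val => ->.
have split_index e s1 s2 a : s = s1 ++ e :: s2 -> a \in s1 -> index a s < index e s.
  move=> def_s a_s1; move: uniq_s; rewrite def_s => /index_uniq_pivot->.
  by rewrite index_cat a_s1 index_mem.
case=> [|[|[|]]].
- case=> x [d [[comp_d opd]]].
  have ds: d \in s by rewrite sE.
  have [s1 [s2 def_s]] := mem_split ds.
  have [q1 [q2 [/lts_run_fifo /= fifo1 st _]]]: exists q1 q2, [/\ lts_run [::] s1 q1,
      lts_step q1 (op_of d) q2 & lts_run q2 s2 qf].
    by apply: lts_run_split; rewrite -def_s.
  have x_s1: x \in pmap enq_val s1.
    rewrite fifo1; move: st; rewrite opd => st; inversion st; subst.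
    by rewrite mem_cat mem_head orbT.
  have [e e_s1 ope] := mem_pmap_op (fun e => @enq_valP e x) x_s1.
  have es: e \in s by rewrite def_s mem_cat e_s1.
  have lt_ed := split_index _ _ _ _ def_s e_s1.
  case=> [/(_ e)[]|[e' [comp_e' ope'] hb_de]]; first by split; rewrite -?sE.
  have e's: e' \in s by rewrite sE.
  have := hb_s d e' ds e's hb_de.
  by rewrite (enq_inj e' e x) // ltnNge ltnW.
- case=> x [d [d' [neq [comp_d opd] [comp_d' opd']]]].
  have ds: d \in s by rewrite sE.
  have d's: d' \in s by rewrite sE.
  have := pmap_index_ltn uniq_deqs ds d's (deqE _ _ opd) (deqE _ _ opd').
  have := pmap_index_ltn uniq_deqs d's ds (deqE _ _ opd') (deqE _ _ opd).
  case: (ltngtP (index d s) (index d' s)) => [_ _ /(_ isT)|_ /(_ isT)|]; rewrite ?ltnn //.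
  by move/(index_inj d ds d's).
- case=> x [y [ex [ey [dx [[comp_ex opex] [comp_ey opey] hb_e [comp_dx opdx]]]]]].
  have [exs eys dxs]: [/\ ex \in s, ey \in s & dx \in s] by rewrite !sE.
  have lt_yx := pmap_index_ltn uniq_enqs eys exs (enqE _ _ opey) (enqE _ _ opex)
                  (hb_s _ _ eys exs hb_e).
  have x_deq: x \in pmap deq_val s.
    by rewrite mem_pmap -(deqE _ _ opdx) map_f.
  (* [y] is enqueued before [x], and [x] lies in the prefix of dequeued values, so [y] does too. *)
  have y_deq: y \in pmap deq_val s.
    move: lt_yx; rewrite fifo !index_cat x_deq; case: ifP => // _.
    by rewrite ltnNge (leq_trans (ltnW _) (leq_addr _ _)) // index_mem.
  have [dy dys opdy] := mem_pmap_op (fun e => @deq_valP e y) y_deq.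
  case=> [/(_ dy)[]|[dy' [comp_dy' opdy'] hb_d]]; first by split; rewrite -?sE.
  have dy's: dy' \in s by rewrite sE.
  have := pmap_index_ltn uniq_deqs dxs dy's (deqE _ _ opdx) (deqE _ _ opdy')
            (hb_s _ _ dxs dy's hb_d).
  move: lt_yx; rewrite fifo !index_cat x_deq y_deq => lt_yx /(ltn_trans lt_yx).
  by rewrite ltnn.
case=> d [c0 [cd [c3 [[comp_d opd] def_c wit]]]].
have ds: d \in s by rewrite sE.
have [s1 [s2 def_s]] := mem_split ds.
have [q1 [q2 [/lts_run_fifo /= fifo1 st _]]]: exists q1 q2, [/\ lts_run [::] s1 q1,
    lts_step q1 (op_of d) q2 & lts_run q2 s2 qf].
  by apply: lts_run_split; rewrite -def_s.
have {st} q1_nil: q1 = [::] by move: st; rewrite opd => st; inversion st.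
rewrite q1_nil cats0 in fifo1.
have comp_a a : a \in d :: s1 -> completed c a.
  by rewrite -sE def_s inE mem_cat inE orbC => /orP[->|->]; rewrite ?orbT.
(* [d] may take effect at the latest invocation [m] among [d] and the events
   before it in [s]: every event completed by then precedes [d] in [s]. *)
have [//|m m_s1 m_max] := @exists_argmin _ (fun a => size c - index (inv a) c) (d :: s1).
have {}m_max a : a \in d :: s1 -> index (inv a) c <= index (inv m) c.
  move=> a_s1; have /andP[] := comp_a a a_s1; have /andP[] := comp_a m m_s1.
  rewrite -!index_mem; have := m_max a a_s1 => + _ _ ia _.
  by rewrite leq_sub2lE // ltnW.
(* Otherwise [d] would precede [m] in real time, although [m] comes before [d] in [s]. *)
have m_res: index (inv m) c < index (res d) c.
  move: m_s1; rewrite inE => /predU1P[->|m_s1]; first exact: index_inv_res.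
  have comp_m: completed c m by rewrite comp_a // inE m_s1 orbT.
  have /andP[im _] := comp_m; rewrite ltnNge -mem2_index ?history_uniq //.
  apply/negP => /hb_s; rewrite ds sE => /(_ isT comp_m).
  by rewrite ltnNge ltnW // (split_index _ _ _ _ def_s).
have uniq_c := history_uniq hist_c.
(* The split of [cd] just after the invocation of [m], with [c1] empty when [m] is [d]. *)
have [c1 [c2 [def_cd take_c]]]: exists c1 c2, cd = c1 ++ c2 /\
    take (index (inv m) c).+1 c = c0 ++ inv d :: c1.
  have le_dm := m_max d (mem_head _ _).
  have i_d: index (inv d) c = size c0.
    by move: uniq_c; rewrite def_c => /index_uniq_pivot.
  have r_d: index (res d) c = size c0 + (size cd).+1.
    by move: uniq_c; rewrite def_c -cat_cons catA => /index_uniq_pivot->; rewrite size_cat.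
  pose k := index (inv m) c - size c0; exists (take k cd), (drop k cd).
  rewrite cat_take_drop; split=> //.
  have -> : (index (inv m) c).+1 = size c0 + k.+1 by rewrite /k; lia.
  rewrite {1}def_c takeD take_size_cat // drop_size_cat //= takel_cat //.
  by rewrite /k; lia.
have [x [e [ope comp_e no_deq]]] := wit c1 c2 def_cd.
have in_pre a : a \in c -> (a \in c0 ++ inv d :: c1) = (index a c <= index (inv m) c).
  by move=> ac; rewrite -take_c in_take.
have sub_pre a : a \in c0 ++ inv d :: c1 -> a \in c.
  by rewrite -take_c; apply: mem_take.
have comp_e': completed c e by case/andP: comp_e => /sub_pre ie /sub_pre re; apply/andP.
have e_s1 : e \in s1.
  have es: e \in s by rewrite sE.
  have ms: m \in s by rewrite sE comp_a.
  have /andP[im _] := comp_a m m_s1; have /andP[_ re] := comp_e.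
  have: hb c e m by rewrite /hb mem2_index // -in_pre // sub_pre.
  move/(hb_s e m es ms) => lt_em.
  have lt_ed: index e s < index d s.
    move: m_s1; rewrite inE => /predU1P[<-//|m_s1].
    exact: ltn_trans lt_em (split_index _ _ _ _ def_s m_s1).
  move: lt_ed; rewrite def_s !index_cat; case: ifP => // _; case: ifP => /= [d_s1|_].
    by rewrite ltnNge ltnW // (leq_trans _ (leq_addr _ _)) ?index_mem.
  by rewrite eqxx addn0 ltnNge leq_addr.
(* The queue is empty after [s1], so [x], enqueued in [s1], is also dequeued there, by an event
   invoked no later than [m]. This contradicts [no_deq]. *)
have x_s1: x \in pmap deq_val s1.
  by rewrite -fifo1 mem_pmap -(enqE _ _ ope) map_f.
have [d' d's1 opd'] := mem_pmap_op (fun e => @deq_valP e x) x_s1.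
have d'_s1: d' \in d :: s1 by rewrite inE d's1 orbT.
have comp_d' := comp_a d' d'_s1; have /andP[id' _] := comp_d'.
by have := no_deq d' (conj comp_d' opd'); rewrite in_pre ?m_max.
Qed.

(** * Complete histories without violation are linearizable *)

(* [p] is a possible linearization point of the NULL dequeue [d] in [c], read
   as the number of actions of [c] that precede it. *)
Definition null_point (c : seq action) (d : event) (p : nat) : bool :=
  (index (inv d) c < p <= index (res d) c) &&
  all (fun e => if op_of e is Enq x then
         completed (take p c) e ==>
           has (fun d' => (op_of d' == Deq (Some x)) && (inv d' \in take p c))
             (events c)
       else true) (events c).

(** A split [cd = c1 ++ c2] corresponds to the instant [size c0 + (size c1).+1]; if no instant is a
    null point, each one fails through an enqueue that witnesses [VWit] for its split. *)
Lemma exists_null_point c d :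
    history c -> complete c -> ~ VWit c -> completed c d -> op_of d = Deq None ->
  exists p, null_point c d p.
Proof.
move=> hist_c complete_c no_wit comp_d opd; have lt_d := index_inv_res hist_c comp_d.
have [/hasP[p _]|/hasPn no_point] := boolP (has (null_point c d) (iota 0 (size c))).
  by exists p.
case: no_wit; have /andP[id rd] := comp_d; have uniq_c := history_uniq hist_c.
have [c0 [cr def_cr]] := mem_split id.
have i_d: index (inv d) c = size c0.
  by move: uniq_c; rewrite def_cr => /index_uniq_pivot.
have rd_cr: res d \in cr.
  move: lt_d rd; rewrite i_d def_cr index_cat mem_cat inE res_neq_inv /=.
  by case: ifP => // rd_c0; rewrite ltnNge ltnW ?index_mem.
have [cd [c3 def_cd]] := mem_split rd_cr.
have def_c: c = c0 ++ inv d :: cd ++ res d :: c3 by rewrite def_cr def_cd.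
have r_d: index (res d) c = size c0 + (size cd).+1.
  by move: uniq_c; rewrite def_c -cat_cons catA => /index_uniq_pivot->; rewrite size_cat.
exists d, c0, cd, c3; split=> // c1 c2 def_c12.
pose p := size c0 + (size c1).+1.
have take_p: take p c = c0 ++ inv d :: c1.
  rewrite def_c def_c12 -!catA -cat_cons catA take_size_cat //.
  by rewrite size_cat.
have le_p: p <= index (res d) c.
  by rewrite r_d def_c12 size_cat leq_add2l ltnS leq_addr.
have lt_p: index (inv d) c < p by rewrite i_d /p addnS ltnS leq_addr.
have := no_point p; rewrite mem_iota /= add0n (leq_ltn_trans le_p) ?index_mem // => /(_ isT).
rewrite /null_point le_p lt_p => /allPn[e].
rewrite mem_events // => comp_e; case ope: (op_of e) => [x|//].
rewrite negb_imply take_p => /andP[comp_p /hasPn no_deq].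
exists x, e; split=> // d' [comp_d' opd'].
by have := no_deq d'; rewrite mem_events // opd' eqxx; apply.
Qed.

Lemma complete_no_violation_linearizable c :
    history c -> complete c -> enqueued_once c ->
    ~ (VFresh c \/ VRepet c \/ VOrd c \/ VWit c) ->
  linearizable c.
Proof.
move=> hist_c complete_c once no_viol.
have uniq_c := history_uniq hist_c.
pose E := events c; have inE' e : (e \in E) = completed c e by apply: mem_events.
(* Actions happen at odd instants, so that NULL points, at even instants, never
   coincide with an action. *)
pose I e := (index (inv e) c).*2.+1; pose O e := (index (res e) c).*2.+1.
(* The first null point of [d]; the default 0 is never reached for a NULL dequeue in [E], by [pP].
   The action at index [i] happens before [q.*2] exactly when [i < q]. *)
pose p d := (head 0 [seq q <- iota 0 (size c).+1 | null_point c d q]).*2.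
have pP d : d \in E -> op_of d = Deq None -> null_point c d (p d)./2.
  rewrite inE' => comp_d opd.
  have [|q qP] := exists_null_point hist_c complete_c _ comp_d opd; first by tauto.
  have q_c: q \in [seq q <- iota 0 (size c).+1 | null_point c d q].
    rewrite mem_filter qP mem_iota /= ltnS; case/andP: qP => /andP[_ /leq_trans-> //].
    exact: index_size.
  rewrite /p doubleK.
  have head_in (qs : seq nat) : q \in qs -> head 0 qs \in qs.
    by case: qs => // q0 qs _; apply: mem_head.
  by have := head_in _ q_c; rewrite mem_filter => /andP[].
have hbE e e' : e \in E -> e' \in E -> hb c e e' = (O e < I e').
  by rewrite !inE' => _ /andP[ie' _]; rewrite hb_index // /O /I ltnS ltn_double.
have [||||||s [perm_s legal_s ord_s]] := @linearization_of_intervals E I O p.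
- exact: events_uniq.
- by move=> e; rewrite inE' => /(index_inv_res hist_c)/ltnW; rewrite ltnS leq_double.
- move=> e e'; rewrite !inE'; apply: completed_op_inj => //; tauto.
- move=> d dE x opd; have [/hasP[e eE /eqP ope]|/hasPn no_e] :=
    boolP (has (fun e => op_of e == Enq x) E).
    exists e; split=> //; rewrite leqNgt -hbE //; apply/negP => hb_de.
    case: no_viol; left; exists x, d; split; first by split; rewrite -?inE'.
    by right; exists e => //; split; rewrite -?inE'.
  case: no_viol; left; exists x, d; split; first by split; rewrite -?inE'.
  by left=> e [comp_e ope]; have := no_e e; rewrite inE' ope eqxx => /(_ comp_e).
- move=> ex ey dx exE eyE dxE x y opex opey opdx; rewrite -hbE // => hb_yx.
  have viol: (forall dy, ~ deq_in c (Some y) dy) \/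
        (exists2 dy, deq_in c (Some y) dy & hb c dx dy) -> False.
    move=> viol; apply: no_viol; right; right; left; exists x, y, ex, ey, dx.
    by split=> //; split; rewrite -?inE'.
  have [/hasP[dy dyE /eqP opdy]|/hasPn no_dy] :=
    boolP (has (fun e => op_of e == Deq (Some y)) E).
    exists dy; split=> //; rewrite leqNgt -hbE //; apply/negP => hb_d.
    by apply: viol; right; exists dy => //; split; rewrite -?inE'.
  case: viol; left=> dy [comp_dy opdy].
  by have := no_dy dy; rewrite inE' opdy eqxx => /(_ comp_dy).
- move=> d dE opd; have /andP[/andP[lt_p le_p] /allP good] := pP d dE opd.
  have p2: p d = (p d)./2.*2 by rewrite /p doubleK.
  move: lt_p le_p good p2; move: (p d)./2 => q lt_p le_p good ->; split.
  + by rewrite /I ltn_double.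
  + by rewrite /O ltnW // ltnS leq_double.
  + by move=> e _; rewrite /I; lia.
  move=> e eE x ope lt_e.
  have := good e eE; rewrite ope; case: (boolP (completed _ _)) => [_|/negP[]].
    case/hasP=> d' d'E /andP[/eqP opd' id']; exists d'; split=> //.
    by move: (index_ltn id'); rewrite /I; lia.
  move: (eE); rewrite inE' => comp_e; have lt_ir := index_inv_res hist_c comp_e.
  case/andP: comp_e => ie re; rewrite /completed !in_take //.
  by move: lt_e; rewrite /O; lia.
exists c; split; first exact: compl_refl.
exists s; split=> //.
  split; first by rewrite (perm_uniq perm_s) events_uniq.
  by move=> e; rewrite (perm_mem perm_s) inE'.
move=> e e' es e's hb_e; apply: ord_s => //; rewrite -hbE //.
  by rewrite -(perm_mem perm_s).
by rewrite -(perm_mem perm_s).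
Qed.

(** * Reduction to complete histories *)

Theorem theorem4p10 (I : Type) (P : implementation I)
  (P_once : forall c, induces P c -> enqueued_once c)
  (P_completable : completable P) :
  impl_linearizable P <->
  (forall c, induces P c -> complete c ->
     ~ (VFresh c \/ VRepet c \/ VOrd c \/ VWit c)).
Proof.
split=> [lin_P c ind_c complete_c|no_viol c ind_c].
  have hist_c: history c by case: ind_c => t /traces_history + ->.
  have [hc [/(compl_complete complete_c) -> [s [ord_s legal_s hb_s]]]] := lin_P c ind_c.
  exact: (legal_complete_no_violation hist_c complete_c (P_once c ind_c) ord_s).
(* The induced completion [hc] is linearizable through its only completion, itself; the same
   ordering therefore linearizes [c]. *)
have [hc compl_hc ind_hc] := P_completable c ind_c.
have [hist_hc complete_hc _] := compl_hc.
have [hc' [compl_hc' lin]] := complete_no_violation_linearizable hist_hc complete_hc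
  (P_once hc ind_hc) (no_viol hc ind_hc complete_hc).
by exists hc; split=> //; rewrite -(compl_complete complete_hc compl_hc').
Qed.
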